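(* Let $G$ be a connected graph on $n$ vertices. If $\operatorname{match}(G)=\lfloor n/2\rfloor$, then for any $n$ distinct real numbers $\lambda_1,\dots,\lambda_n$ such that $\lambda_j=-\lambda_{n+1-j}$ for all $j=1,\dots,n$, there is a matrix $A\in S^-(G)$ with eigenvalues $i\lambda_1,\dots,i\lambda_n$ (where $i=\sqrt{-1}$). Conversely, if there is a matrix $A\in S^-(G)$ with distinct eigenvalues, then $\operatorname{match}(G)=\lfloor n/2\rfloor$.
   Context: $\operatorname{match}(G)$ is the matching number of $G$ (maximum number of pairwise vertex-disjoint edges). For a graph $G$ on vertex set $\{1,\dots,n\}$, $S^-(G)$ is the set of all $n\times n$ real skew-symmetric matrices $A=[a_{ij}]$ whose graph is $G$, i.e. for $i\ne j$, $a_{ij}\neq 0$ if and only if $\{i,j\}$ is an edge of $G$. *)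

(* Defs.v *)
From mathcomp Require Export all_boot all_order all_algebra.
From mathcomp Require Export reals.
From mathcomp.real_closed Require Export complex.
Set Implicit Arguments.
Unset Strict Implicit.
Unset Printing Implicit Defensive.
Import Order.TTheory GRing.Theory Num.Theory.
Local Open Scope ring_scope.

Definition simple_graph (n : nat) (e : rel 'I_n) : Prop :=
  symmetric e /\ irreflexive e.

Definition connected_graph (n : nat) (e : rel 'I_n) : Prop :=
  forall x y : 'I_n, connect e x y.

Definition edges (n : nat) (e : rel 'I_n) : {set {set 'I_n}} :=
  [set [set x; y] | x in 'I_n, y in 'I_n & e x y].

Definition is_matching (n : nat) (e : rel 'I_n) (M : {set {set 'I_n}}) : bool :=
  (M \subset edges e) && trivIset M.

Definition matching_number (n : nat) (e : rel 'I_n) : nat :=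
  \max_(M : {set {set 'I_n}} | is_matching e M) #|M|.

(* The set S^-(G); the diagonal vanishes by skew-symmetry. *)
Definition skew_of_graph (R : realType) (n : nat) (e : rel 'I_n)
    (A : 'M[R]_n) : Prop :=
  A^T = - A /\ (forall i j : 'I_n, i != j -> (A i j != 0 <-> e i j)).

(* s lists the complex eigenvalues of the real matrix A, each repeated
   according to its algebraic multiplicity. *)
Definition has_eigenvalues (R : realType) (n : nat) (A : 'M[R]_n)
    (s : seq R[i]) : Prop :=
  char_poly (map_mx (real_complex R) A) = \prod_(z <- s) ('X - z%:P).

(* Main.v *)
From HB Require Import structures.
From mathcomp Require Import classical_sets functions topology.
From mathcomp Require Import interval_inference normedtype sequences.
Require Import Defs.
From mathcomp Require Import all_boot all_order all_algebra.
From mathcomp Require Import reals.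
From mathcomp.real_closed Require Import complex.
From mathcomp Require Import spectral ring lra zify.
Set Implicit Arguments.
Unset Strict Implicit.
Unset Printing Implicit Defensive.
Import Order.TTheory GRing.Theory Num.Theory.
Local Open Scope ring_scope.
Local Open Scope complex_scope.

(** Existence. Put weights [x_k] on the edges of a matching of size [n %/ 2] and
    weight [eps] (up to sign) on all other edges, obtaining a skew matrix
    [A x eps]. Since [A x eps] is skew, [F_k x eps := det (mu_k + i A x eps)] is
    real, and the [mu_k] together with their opposites (and [0] when [n] is odd)
    are the required spectrum as soon as all [F_k] vanish. At [eps = 0] the matrix
    is a sum of 2x2 blocks, so [F_k x 0 = mu_k ^ (n - 2 m) *
    prod_j (mu_k ^ 2 - x_j ^ 2)]; the Jacobian of [F] in [x] at [x = mu] is thus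
    diagonal with nonzero entries, and Newton's map is a contraction near [mu]
    for all small [eps], which gives a zero with [eps != 0].

    Necessity. If the principal submatrix of a skew [A] on [U] is nonsingular and
    [i] is in [U], solve [w A = e_i] on [U]; some [j] has [w_j != 0] and
    [A_ij != 0], and the principal submatrix on [U] minus [{i, j}] is again
    nonsingular, so [U] has a perfect matching by induction. A skew matrix with
    distinct eigenvalues has a kernel of dimension at most one, hence is
    nonsingular either on all vertices or on all but one of them. *)

(** * Fixed points in a box *)

(** The closed ball of the sup norm, spelled out by coordinates so that bounds on a single
    coordinate apply directly. *)
Definition box (R : realType) (m : nat) (c : 'rV[R]_m) (r : R) (x : 'rV[R]_m) :=
  forall j, `|x 0 j - c 0 j| <= r.

Section BoxFixedPoint.
Import numFieldNormedType.Exports.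
Local Open Scope classical_set_scope.

HB.instance Definition _ (R : realType) (m n : nat) := Complete.on 'M[R]_(m, n).

Lemma row_norm_leP (R : realType) (m : nat) (x : 'rV[R]_m) (d : R) :
  0 <= d -> (`|x| <= d) <-> (forall j, `|x 0 j| <= d).
Proof.
move=> d0; rewrite -[`|x|]/(mx_norm x) mx_normrE; split=> [/bigmax_leP[_ H] j|H].
  exact: (H (0, j)).
by apply/bigmax_leP; split=> // -[i j] _ /=; rewrite ord1.
Qed.

(** Banach's contraction principle with factor 1/2. Contraction is phrased through any common bound
    [d] on the coordinate differences, which keeps norms of vectors out of the later estimates. *)
Lemma box_fixed_point (R : realType) (m : nat) (c : 'rV[R]_m) (r : R)
    (T : 'rV[R]_m -> 'rV[R]_m) :
  0 < r -> (forall x, box c r x -> box c r (T x)) ->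
  (forall x y d, box c r x -> box c r y -> 0 <= d ->
     box y d x -> box (T y) (d / 2) (T x)) ->
  exists2 x, box c r x & T x = x.
Proof.
move=> r0 Tstab Tctr; pose U : set 'rV[R]_m := closed_ball c r.
have UP x : U x <-> box c r x.
  rewrite /U closed_ballE // /closed_ball_ /= row_norm_leP ?ltW //.
  by split=> H j; have := H j; rewrite !mxE distrC.
have TU : set_fun U U T by move=> x /UP/Tstab/UP.
pose TF := HB.pack_for {fun U >-> U} T (isFun.Build _ _ U U T TU).
have [| | |x /UP Ux xE] := @banach_fixed_point R 'rV[R]_m U TF.
- exists (2^-1 : R)%:nng; split=> /=; first by lra.
  move=> [x y] [/= /UP Ux /UP Uy]; rewrite mulrC.
  apply/row_norm_leP=> [|j]; first by rewrite mulr_ge0 // invr_ge0.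
  have := Tctr x y `|x - y| Ux Uy (normr_ge0 _); rewrite /box.
  have xy : forall j0, `|(x - y) 0 j0| <= `|x - y| by apply/row_norm_leP.
  move=> /(_ _ j); rewrite !mxE; apply=> j0.
  by have := xy j0; rewrite !mxE.
- exact: closed_ball_closed.
- by exists c; apply: closed_ballxx.
by exists x.
Qed.
End BoxFixedPoint.

(** * Perturbed equations *)

(** One constant [L], uniform in [eps], serves both as a bound and as a Lipschitz constant in [x]:
    the product rule needs the two together. *)
Definition lipschitz_near (R : realType) (m : nat) (c : 'rV[R]_m)
    (f : 'rV[R]_m -> R -> R) : Prop :=
  exists2 L, 0 <= L &
    forall x eps, box c 1 x -> `|eps| <= 1 ->
      `|f x eps| <= L /\
      forall y d, box c 1 y -> 0 <= d -> box y d x ->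
        `|f x eps - f y eps| <= L * d.

Section LipschitzNear.
Variables (R : realType) (m : nat) (c : 'rV[R]_m).
Implicit Types f g : 'rV[R]_m -> R -> R.

Lemma lipschitz_near_ext f g :
  f =2 g -> lipschitz_near c f -> lipschitz_near c g.
Proof.
move=> fg [L L0 H]; exists L => // x eps cx e1; have [H1 H2] := H x eps cx e1.
by split=> [|y d cy d0 yx]; rewrite -!fg //; apply: H2.
Qed.

Lemma lipschitz_near_const (a : R) : lipschitz_near c (fun _ _ => a).
Proof.
exists `|a| => // x eps _ _; split=> // y d _ d0 _.
by rewrite subrr normr0 mulr_ge0.
Qed.

Lemma lipschitz_near_eps : lipschitz_near c (fun _ eps => eps).
Proof.
exists 1 => // x eps _ e1; split=> // y d _ d0 _.
by rewrite subrr normr0 mul1r.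
Qed.

Lemma lipschitz_near_coord j : lipschitz_near c (fun x _ => x 0 j).
Proof.
exists (1 + `|c 0 j|) => [|x eps cx _]; first by rewrite addr_ge0.
split=> [|y d _ d0 /(_ j) yx].
  have := ler_normD (x 0 j - c 0 j) (c 0 j); rewrite subrK => /le_trans; apply.
  by rewrite lerD2r.
by rewrite (le_trans yx) // ler_peMl // lerDl.
Qed.

Lemma lipschitz_nearD f g :
  lipschitz_near c f -> lipschitz_near c g ->
  lipschitz_near c (fun x eps => f x eps + g x eps).
Proof.
move=> [Lf Lf0 Hf] [Lg Lg0 Hg]; exists (Lf + Lg) => [|x eps cx e1].
  exact: addr_ge0.
have [fb fl] := Hf x eps cx e1; have [gb gl] := Hg x eps cx e1; split.
  by rewrite (le_trans (ler_normD _ _)) // lerD.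
move=> y d cy d0 yx; rewrite opprD addrACA mulrDl.
by rewrite (le_trans (ler_normD _ _)) // lerD ?fl ?gl.
Qed.

Lemma lipschitz_nearM f g :
  lipschitz_near c f -> lipschitz_near c g ->
  lipschitz_near c (fun x eps => f x eps * g x eps).
Proof.
move=> [Lf Lf0 Hf] [Lg Lg0 Hg]; exists (Lf * Lg *+ 2) => [|x eps cx e1].
  by rewrite mulrn_wge0 // mulr_ge0.
have [fb fl] := Hf x eps cx e1; have [gb gl] := Hg x eps cx e1; split.
  have LL : 0 <= Lf * Lg by rewrite mulr_ge0.
  rewrite normrM (le_trans (ler_pM _ _ fb gb)) //; lra.
move=> y d cy d0 yx; have [gby _] := Hg y eps cy e1.
have -> : f x eps * g x eps - f y eps * g y eps =
  f x eps * (g x eps - g y eps) + (f x eps - f y eps) * g y eps by ring.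
rewrite (le_trans (ler_normD _ _)) // !normrM.
have -> : Lf * Lg *+ 2 * d = Lf * (Lg * d) + Lf * d * Lg by ring.
by rewrite lerD // ler_pM // ?fl ?gl.
Qed.

End LipschitzNear.

(* The [eps]-dependent part of [f] keeps a factor [eps], so that its Lipschitz
   constant in [x] tends to [0] with [eps]. *)
Definition perturbation (R : realType) (m : nat) (c : 'rV[R]_m)
    (f : 'rV[R]_m -> R -> R) : Prop :=
  exists g h, [/\ lipschitz_near c (fun x _ => g x), lipschitz_near c h &
    forall x eps, f x eps = g x + eps * h x eps].

Section Perturbation.
Variables (R : realType) (m : nat) (c : 'rV[R]_m).
Implicit Types f g : 'rV[R]_m -> R -> R.

Lemma perturbation_const (a : R) : perturbation c (fun _ _ => a).
Proof.
exists (fun=> a), (fun _ _ => 0); split=> *; try exact: lipschitz_near_const.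
by rewrite mulr0 addr0.
Qed.

Lemma perturbation_eps : perturbation c (fun _ eps => eps).
Proof.
exists (fun=> 0), (fun _ _ => 1); split=> *; try exact: lipschitz_near_const.
by rewrite mulr1 add0r.
Qed.

Lemma perturbation_coord j : perturbation c (fun x _ => x 0 j).
Proof.
exists (fun x => x 0 j), (fun _ _ => 0); split=> *.
- exact: lipschitz_near_coord.
- exact: lipschitz_near_const.
by rewrite mulr0 addr0.
Qed.

Lemma perturbationD f g : perturbation c f -> perturbation c g ->
  perturbation c (fun x eps => f x eps + g x eps).
Proof.
move=> [f0 [f1 [Lf0 Lf1 fE]]] [g0 [g1 [Lg0 Lg1 gE]]].
exists (fun x => f0 x + g0 x), (fun x eps => f1 x eps + g1 x eps).
by split=> *; [exact: lipschitz_nearD|exact: lipschitz_nearD|rewrite fE gE; ring].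
Qed.

Lemma perturbationM f g : perturbation c f -> perturbation c g ->
  perturbation c (fun x eps => f x eps * g x eps).
Proof.
move=> [f0 [f1 [Lf0 Lf1 fE]]] [g0 [g1 [Lg0 Lg1 gE]]].
(* The product is expanded and one factor [eps] taken out; the quadratic term keeps the other one,
   which is itself bounded by 1 near [c]. *)
exists (fun x => f0 x * g0 x), (fun x eps =>
  f0 x * g1 x eps + (f1 x eps * g0 x + eps * (f1 x eps * g1 x eps))).
split=> [||x eps]; last by rewrite fE gE; ring.
  exact: lipschitz_nearM.
apply: lipschitz_nearD; first exact: lipschitz_nearM.
apply: lipschitz_nearD; first exact: lipschitz_nearM.
by apply: lipschitz_nearM (lipschitz_near_eps _) _; exact: lipschitz_nearM.
Qed.

End Perturbation.

(* Newton's map [N] for [f] in the single coordinate [k]: at [eps = 0] all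
   partial derivatives of [N] vanish at [c], because the factor
   [x_k ^ 2 - c_k ^ 2] of [f] does. *)
Lemma newton_step (R : realType) (m : nat) (c : 'rV[R]_m) (k : 'I_m)
    (u : 'rV[R]_m -> R) (h : 'rV[R]_m -> R -> R)
    (N := fun (x : 'rV[R]_m) eps => x 0 k -
       ((x 0 k ^+ 2 - c 0 k ^+ 2) * u x + eps * h x eps) / (2 * c 0 k * u c)) :
  lipschitz_near c (fun x _ => u x) -> lipschitz_near c h ->
  c 0 k != 0 -> u c != 0 ->
  exists2 K, 0 <= K & forall rho eps, 0 <= rho <= 1 -> `|eps| <= 1 ->
    `|N c eps - c 0 k| <= K * `|eps| /\
    forall x y d, box c rho x -> box c rho y -> 0 <= d -> box y d x ->
      `|N x eps - N y eps| <= K * (rho + `|eps|) * d.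
Proof.
move=> [Lu Lu0 Hu] [Lh Lh0 Hh] ck uc.
(* [D] is the partial derivative in [x_k], at [c], of the unperturbed part
   [(x_k ^ 2 - c_k ^ 2) * u x]. *)
set D := 2 * c 0 k * u c; pose C := `|c 0 k|.
have D0 : D != 0 by rewrite !mulf_neq0 // pnatr_eq0.
have C0 : 0 <= C by rewrite normr_ge0.
(* The factor [3 + 4 * C] adds up the coefficients of [Lu * rho * d] in [A1] and [A2] below. *)
pose K := (Lu + Lh) * (3 + 4 * C).
have K0 : 0 <= K by rewrite mulr_ge0 ?addr_ge0 // mulr_ge0.
have cc r : 0 <= r -> box c r c by move=> r0 j; rewrite subrr normr0.
exists (K / `|D|) => [|rho eps /andP[r0 r1] e1]; first by rewrite mulr_ge0 ?invr_ge0.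
split=> [|x y d cx cy d0 yx].
  have -> : N c eps - c 0 k = - (eps * h c eps) / D by rewrite /N -/D; field.
  rewrite normrM normrN normfV normrM [K / _ * _]mulrAC; apply: ler_wpM2r.
    by rewrite invr_ge0.
  rewrite mulrC; apply: ler_wpM2r => //.
  have [/le_trans-> //] := Hh c eps (cc 1 ler01) e1.
  by rewrite /K; nra.
have box1 z : box c rho z -> box c 1 z by move=> cz j; rewrite (le_trans (cz j)).
have [ub ul] := Hu x eps (box1 _ cx) e1.
have [_ hl] := Hh x eps (box1 _ cx) e1.
have u1 := ul c rho (cc 1 ler01) r0 cx.
have u2 := ul y d (box1 _ cy) d0 yx.
have h1 := hl y d (box1 _ cy) d0 yx.
(* Dividing by [D] cancels the linear part of the difference; every term left carries a small
   factor, either a distance to [c] or [eps]. *)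
have -> : N x eps - N y eps = - ((x 0 k - y 0 k) *
    ((x 0 k - c 0 k + (y 0 k - c 0 k)) * u x + 2 * c 0 k * (u x - u c)) +
    (y 0 k - c 0 k) * (y 0 k - c 0 k + 2 * c 0 k) * (u x - u y) +
    eps * (h x eps - h y eps)) / D.
  by rewrite /N /D; field; rewrite ck uc.
rewrite normrM normrN normfV [K / _ * _]mulrAC -[_ * d]mulrAC.
apply: ler_wpM2r; first by rewrite invr_ge0.
have xk := cx k; have yk := cy k; have xy := yx k.
rewrite (le_trans (ler_normD _ _)) //.
have A1 : `|(x 0 k - y 0 k) * ((x 0 k - c 0 k + (y 0 k - c 0 k)) * u x
   + 2 * c 0 k * (u x - u c))| <= d * ((rho + rho) * Lu + 2 * C * (Lu * rho)).
  rewrite normrM ler_pM // (le_trans (ler_normD _ _)) // lerD // normrM.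
    by rewrite ler_pM // (le_trans (ler_normD _ _)) // lerD.
  by rewrite ler_pM // normrM ger0_norm.
have A2 : `|(y 0 k - c 0 k) * (y 0 k - c 0 k + 2 * c 0 k) * (u x - u y)|
   <= rho * (1 + 2 * C) * (Lu * d).
  rewrite normrM ler_pM // normrM ler_pM // (le_trans (ler_normD _ _)) //.
  by rewrite lerD ?(le_trans yk) // normrM ger0_norm.
have A3 : `|eps * (h x eps - h y eps)| <= `|eps| * (Lh * d).
  by rewrite normrM ler_wpM2l.
rewrite (le_trans (lerD (le_trans (ler_normD _ _) (lerD A1 A2)) A3)) //.
rewrite -subr_ge0.
have -> : K * (rho + `|eps|) * d - (d * ((rho + rho) * Lu + 2 * C * (Lu * rho)) +
   rho * (1 + 2 * C) * (Lu * d) + `|eps| * (Lh * d)) =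
   d * (Lh * (rho * (3 + 4 * C)) + Lu * (`|eps| * (3 + 4 * C)) +
        Lh * (`|eps| * (2 + 4 * C))) by rewrite /K; ring.
by rewrite !(mulr_ge0, addr_ge0).
Qed.

(** Since the conditions are upward closed, the sum of the individual thresholds serves all indices;
    adding 1 makes it positive. *)
Lemma uniform_bound (R : realType) (m : nat) (P : 'I_m -> R -> Prop) :
  (forall k a b, a <= b -> P k a -> P k b) ->
  (forall k, exists2 a, 0 <= a & P k a) ->
  exists2 a, 0 < a & forall k, P k a.
Proof.
move=> Pmono Pex; have [a a0 aP] := fin_all_exists2 Pex.
have sge0 : 0 <= \sum_k a k by rewrite sumr_ge0.
exists (1 + \sum_k a k) => [|k]; first by rewrite ltr_pwDl.
apply: Pmono (aP k); rewrite (bigD1 k) //= addrCA lerDl addr_ge0 //.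
by rewrite sumr_ge0.
Qed.

Lemma perturbed_zero (R : realType) (m : nat) (c : 'rV[R]_m) (r : R)
    (f : 'I_m -> 'rV[R]_m -> R -> R) (u : 'I_m -> 'rV[R]_m -> R) :
  (forall k, perturbation c (f k)) ->
  (forall k, lipschitz_near c (fun x _ => u k x)) ->
  (forall k x, f k x 0 = (x 0 k ^+ 2 - c 0 k ^+ 2) * u k x) ->
  (forall k, c 0 k != 0) -> (forall k, u k c != 0) -> 0 < r ->
  exists x eps, [/\ eps != 0, box c r x & forall k, f k x eps = 0].
Proof.
move=> fP uL f0 c0 u0 r0.
(* Setting [eps = 0] identifies the [eps]-free part of each [f k] with the given product. *)
have /fin_all_exists2[h hL fE] : forall k, exists2 h, lipschitz_near c h &
    forall x eps, f k x eps = (x 0 k ^+ 2 - c 0 k ^+ 2) * u k x + eps * h x eps.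
  move=> k; have [g [h [_ hL fE]]] := fP k; exists h => // x eps.
  by rewrite -f0 !fE mul0r addr0.
pose N k (x : 'rV[R]_m) eps := x 0 k - f k x eps / (2 * c 0 k * u k c).
have NE k x eps : N k x eps = x 0 k - ((x 0 k ^+ 2 - c 0 k ^+ 2) * u k x +
    eps * h k x eps) / (2 * c 0 k * u k c) by rewrite /N fE.
have [|k|K K0 HK] := @uniform_bound R m (fun k K =>
    forall rho eps, 0 <= rho <= 1 -> `|eps| <= 1 ->
    `|N k c eps - c 0 k| <= K * `|eps| /\
    forall x y d, box c rho x -> box c rho y -> 0 <= d -> box y d x ->
      `|N k x eps - N k y eps| <= K * (rho + `|eps|) * d).
- move=> k a b ab H rho eps r01 e1; have [H1 H2] := H rho eps r01 e1.
  split=> [|x y d cx cy d0 yx].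
    by rewrite (le_trans H1) // ler_wpM2r.
  rewrite (le_trans (H2 x y d cx cy d0 yx)) // ler_wpM2r // ler_wpM2r //.
  by rewrite addr_ge0 //; case/andP: r01.
- have [K K0 HK] := newton_step (uL k) (hL k) (c0 k) (u0 k).
  exists K => // rho eps r01 e1; have [H1 H2] := HK rho eps r01 e1.
  split=> [|x y d cx cy d0 yx]; first by rewrite NE.
  by rewrite !NE; apply: H2.
(* These choices give [K * rho <= 1/4] and [K * eps <= rho / 4]. Newton's map then contracts by 1/2
   on the box of radius [rho] and moves its centre by at most [rho / 4], so it preserves that
   box. *)
pose rho := Num.min (Num.min 1 r) (4 * K)^-1.
pose eps := rho * Num.min 1 (4 * K)^-1.
have K4 : 0 < (4 * K)^-1 by rewrite invr_gt0 mulr_gt0.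
have rho0 : 0 < rho by rewrite !lt_min ltr01 r0 K4.
have rho1 : rho <= 1 by rewrite !ge_min lexx.
have rhor : rho <= r by rewrite !ge_min lexx orbT.
have rhoK : K * rho <= 4^-1.
  have : rho <= (4 * K)^-1 by rewrite !ge_min lexx orbT.
  by rewrite -[_ <= _](ler_pM2l K0) invfM mulrCA divff ?mulr1 // gt_eqF.
have t0 : 0 < Num.min 1 (4 * K)^-1 by rewrite lt_min ltr01.
have t1 : Num.min 1 (4 * K)^-1 <= 1 by rewrite ge_min lexx.
have tK : K * Num.min 1 (4 * K)^-1 <= 4^-1.
  have : Num.min 1 (4 * K)^-1 <= (4 * K)^-1 by rewrite ge_min lexx orbT.
  by rewrite -[_ <= _](ler_pM2l K0) invfM mulrCA divff ?mulr1 // gt_eqF.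
have eps0 : 0 < eps by rewrite mulr_gt0.
have epsr : eps <= rho by rewrite ler_piMr // ltW.
have eps1 : `|eps| <= 1 by rewrite gtr0_norm // (le_trans epsr).
have Keps : K * eps <= rho / 4 by rewrite mulrCA ler_wpM2l // ltW.
have r01 : 0 <= rho <= 1 by rewrite ltW.
pose T (x : 'rV[R]_m) : 'rV[R]_m := \row_k N k x eps.
have Tctr x y d : box c rho x -> box c rho y -> 0 <= d ->
    box y d x -> box (T y) (d / 2) (T x).
  move=> cx cy d0 yx k; rewrite !mxE.
  have [_ /(_ x y d cx cy d0 yx)/le_trans] := HK k rho eps r01 eps1; apply.
  rewrite mulrC ler_wpM2l // gtr0_norm // mulrDr; lra.
have [|x cx Tx] := @box_fixed_point R m c rho T rho0 _ Tctr.
- move=> x cx k.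
  have cc : box c rho c by move=> j; rewrite subrr normr0 ltW.
  have /(_ k) := Tctr x c rho cx cc (ltW rho0) cx.
  have [] := HK k rho eps r01 eps1; rewrite !mxE (gtr0_norm eps0) => Nc _ Nx.
  have -> : N k x eps - c 0 k = N k x eps - N k c eps + (N k c eps - c 0 k) by ring.
  rewrite (le_trans (ler_normD _ _)) // (le_trans (lerD Nx Nc)) //; lra.
exists x, eps; split=> [|j|k]; first by rewrite gt_eqF.
  exact: le_trans (cx j) rhor.
have /rowP/(_ k) := Tx; rewrite mxE /N => /eqP.
rewrite -subr_eq0 addrAC subrr add0r oppr_eq0 mulf_eq0 invr_eq0.
by rewrite !mulf_eq0 (negPf (c0 k)) (negPf (u0 k)) pnatr_eq0 !orbF => /eqP.
Qed.

(** * The matrix of a matching *)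

(** An enumerated and oriented matching; the orientation fixes the signs of the two entries that an
    edge carries in a skew matrix. *)
Definition matching_ends (n m : nat) (e : rel 'I_n) (a b : 'I_m -> 'I_n) :=
  [/\ forall k, e (a k) (b k), injective a, injective b &
      forall k l, a k != b l].

Lemma matching_ends_exist (n m : nat) (e : rel 'I_n) (M : {set {set 'I_n}}) :
  irreflexive e -> is_matching e M -> #|M| = m ->
  exists a b : 'I_m -> 'I_n, matching_ends e a b.
Proof.
move=> irr /andP[/subsetP Me /trivIsetP tM] <-.
have /fin_all_exists2[p ep pE] : forall k : 'I_#|M|,
    exists2 p : 'I_n * 'I_n, e p.1 p.2 & enum_val k = [set p.1; p.2].
  move=> k; have /imset2P[x y _] := Me _ (enum_valP k).
  by rewrite inE /= => exy ->; exists (x, y).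
have pinj (k l : 'I_#|M|) (z : 'I_n) :
    z \in (enum_val k : {set _}) -> z \in (enum_val l : {set _}) -> k = l.
  move=> zk zl; apply/enum_val_inj/eqP; apply: contraT => /tM.
  move=> /(_ (enum_valP _) (enum_valP _))/disjoint_setI0/setP/(_ z).
  by rewrite !inE zk zl.
exists (fun k => (p k).1), (fun k => (p k).2); split=> [//|k l kl|k l kl|k l].
- by apply: (pinj _ _ (p k).1); rewrite pE !inE ?kl eqxx.
- by apply: (pinj _ _ (p k).2); rewrite pE !inE ?kl eqxx orbT.
(* A shared vertex forces [k = l], and then the edge would be a loop. *)
apply/eqP=> kl; have kl' : k = l.
  by apply: (pinj _ _ (p k).1); rewrite pE !inE ?kl eqxx ?orbT.
by have := ep k; rewrite kl kl' irr.
Qed.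

Definition matching_mx (F : pzRingType) (n m : nat) (a b : 'I_m -> 'I_n)
    (x : 'I_m -> F) : 'M[F]_n :=
  \sum_k x k *: (delta_mx (a k) (b k) - delta_mx (b k) (a k)).

Section MatchingMatrix.
Variables (n m : nat) (e : rel 'I_n) (a b : 'I_m -> 'I_n).
Hypothesis ab : matching_ends e a b.

Let a_inj : injective a. Proof. by case: ab. Qed.
Let b_inj : injective b. Proof. by case: ab. Qed.
Let neq_ab k l : (a k == b l) = false.
Proof. by case: ab => _ _ _ /(_ k l)/negPf. Qed.
Let neq_ba k l : (b k == a l) = false. Proof. by rewrite eq_sym. Qed.

Lemma tr_matching_mx (F : pzRingType) (x : 'I_m -> F) :
  (matching_mx a b x)^T = - matching_mx a b x.
Proof.
rewrite /matching_mx -sumrN raddf_sum /=; apply: eq_bigr => k _.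
by rewrite linearZ linearB /= !trmx_delta -scalerN opprB.
Qed.

Lemma matching_mx_entry (F : pzRingType) (x : 'I_m -> F) k :
  matching_mx a b x (a k) (b k) = x k.
Proof.
rewrite summxE (bigD1 k) //= big1 => [|l lk]; rewrite !mxE ?eqxx ?neq_ab /=.
  by rewrite subr0 mulr1 addr0.
by rewrite (inj_eq a_inj) eq_sym (negPf lk) subrr mulr0.
Qed.

Lemma matching_mx_eq0 (F : pzRingType) (x : 'I_m -> F) i j :
  (forall k, ~~ ((i == a k) && (j == b k) || (i == b k) && (j == a k))) ->
  matching_mx a b x i j = 0.
Proof.
move=> H; rewrite summxE big1 // => k _; rewrite !mxE.
by have := H k; rewrite negb_or => /andP[/negPf-> /negPf->]; rewrite subrr mulr0.
Qed.

(** Distinct edges share no vertex, so their cross products vanish, and the 2x2 block of edge [k]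
    squares to [- x k ^+ 2] times the identity on its two ends. *)
Lemma matching_mx_sqr (F : comPzRingType) (x : 'I_m -> F) :
  matching_mx a b x *m matching_mx a b x =
  - diag_mx (\row_i \sum_k x k ^+ 2 * ((i == a k)%:R + (i == b k)%:R)).
Proof.
rewrite {1}/matching_mx mulmx_suml.
have -> : diag_mx (\row_i \sum_k x k ^+ 2 * ((i == a k)%:R + (i == b k)%:R))
   = \sum_k x k ^+ 2 *: (delta_mx (a k) (a k) + delta_mx (b k) (b k)).
  apply/matrixP=> i j; rewrite summxE !mxE -sumrMnl; apply: eq_bigr => k _.
  rewrite !mxE; have [<-|ij] := eqVneq i j; first by rewrite !andbb mulr1n.
  rewrite mulr0n; have [ia|] := eqVneq i (a k); have [ib|] := eqVneq i (b k);
    rewrite /= -?ia -?ib ?(eq_sym j) ?(negPf ij) ?addr0 ?mulr0 //.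
rewrite -sumrN; apply: eq_bigr => k _; rewrite /matching_mx mulmx_sumr.
rewrite (bigD1 k) //= big1 ?addr0 => [|l lk].
  rewrite -scalemxAl -scalemxAr scalerA -expr2 -scalerN; congr (_ *: _).
  rewrite mulmxBl !mulmxBr !mul_delta_mx_cond !eqxx neq_ab neq_ba !mulr0n !mulr1n.
  by rewrite sub0r subr0 opprD.
rewrite -scalemxAl -scalemxAr mulmxBl !mulmxBr !mul_delta_mx_cond.
rewrite neq_ab neq_ba (inj_eq a_inj) (inj_eq b_inj) eq_sym (negPf lk) !mulr0n.
by rewrite !subr0 !scaler0.
Qed.

Lemma prod_matching (F : comNzRingType) (G : 'I_n -> F) (H : 'I_m -> F) (z : F) :
  (forall k, G (a k) = H k) -> (forall k, G (b k) = H k) ->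
  (forall i, (forall k, (i != a k) && (i != b k)) -> G i = z) ->
  \prod_i G i = z ^+ (n - 2 * m) * (\prod_k H k) ^+ 2.
Proof.
move=> Ga Gb Gz; pose Ia := a @: 'I_m; pose Ib := b @: 'I_m.
have disj : Ia :&: Ib = set0.
  apply/setP=> i; rewrite !inE; apply/andP=> -[/imsetP[k _ ->] /imsetP[l _ /eqP]].
  by rewrite neq_ab.
have cardI : #|~: (Ia :|: Ib)| = (n - 2 * m)%N.
  rewrite cardsCs setCK cardsU disj cards0 subn0 !card_imset // !card_ord; lia.
rewrite (bigID [in Ia :|: Ib]) /= mulrC; congr (_ * _).
  rewrite -cardI -prodr_const; apply: eq_big => [i|i]; first by rewrite !inE.
  move=> iI; apply: Gz => k; move: iI; rewrite !inE negb_or => /andP[ia ib].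
  by apply/andP; split; [apply: contraNneq ia|apply: contraNneq ib] => ->;
    apply: imset_f.
rewrite (big_setID Ia) /= expr2; congr (_ * _).
  rewrite setIUl setIid (setIC Ib) disj setU0 big_imset /=; last first.
    by move=> ? ? _ _; apply: a_inj.
  exact: eq_bigr.
have -> : (Ia :|: Ib) :\: Ia = Ib.
  by rewrite setDUl setDv set0U; apply/setDidPl; rewrite -setI_eq0 setIC disj.
rewrite big_imset /=; last by move=> ? ? _ _; apply: b_inj.
exact: eq_bigr.
Qed.

(** Transposition gives [det (z - S) = det (z + S)], so the square is [det (z ^ 2 - S ^ 2)], the
    determinant of a diagonal matrix. *)
Lemma det_sub_matching_mx_sqr (F : comNzRingType) (x : 'I_m -> F) (z : F) :
  \det (z%:M - matching_mx a b x) ^+ 2 =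
  (z ^+ (n - 2 * m) * \prod_k (z ^+ 2 + x k ^+ 2)) ^+ 2.
Proof.
set S := matching_mx a b x.
have detE : \det (z%:M - S) = \det (z%:M + S).
  by rewrite -det_tr linearB /= tr_scalar_mx tr_matching_mx opprK.
rewrite expr2 {2}detE -det_mulmx mulmxBl !mulmxDr (scalar_mxC z S) addrKA -scalar_mxM.
rewrite matching_mx_sqr opprK -diag_const_mx -raddfD /= det_diag.
rewrite exprMn -exprM mulnC exprM; apply: prod_matching => [k|k|i iab].
- rewrite !mxE (bigD1 k) //= big1 ?addr0 => [|l lk].
    by rewrite eqxx neq_ab addr0 mulr1.
  by rewrite neq_ab (inj_eq a_inj) eq_sym (negPf lk) addr0 mulr0.
- rewrite !mxE (bigD1 k) //= big1 ?addr0 => [|l lk].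
    by rewrite eqxx neq_ba add0r mulr1.
  by rewrite neq_ba (inj_eq b_inj) eq_sym (negPf lk) addr0 mulr0.
rewrite !mxE big1 ?addr0 // => k _.
by have /andP[/negPf-> /negPf->] := iab k; rewrite addr0 mulr0.
Qed.

(* Both sides of [det_sub_matching_mx_sqr] are squares of monic polynomials in
   [z], which fixes the sign. *)
Lemma det_sub_matching_mx (F : numFieldType) (x : 'I_m -> F) (z : F) :
  \det (z%:M - matching_mx a b x) =
  z ^+ (n - 2 * m) * \prod_k (z ^+ 2 + x k ^+ 2).
Proof.
have horner_charE (A : 'M[F]_n) : (char_poly A).[z] = \det (z%:M - A).
  rewrite /char_poly -horner_evalE -det_map_mx; congr (\det _).
  by apply/matrixP=> i j; rewrite !mxE /= horner_evalE !hornerE hornerMn hornerX.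
pose p : {poly F} := 'X ^+ (n - 2 * m) * \prod_k ('X ^+ 2 + (x k)%:P ^+ 2).
have pE : char_poly (matching_mx a b x) = p.
  have mapE : map_mx polyC (matching_mx a b x) = matching_mx a b (fun k => (x k)%:P).
    rewrite raddf_sum /=; apply: eq_bigr => k _.
    by rewrite map_mxZ map_mxB !map_delta_mx.
  have /eqP := det_sub_matching_mx_sqr (fun k => (x k)%:P) 'X.
  rewrite -mapE -/(char_poly_mx _) -/(char_poly _) -/p eqf_sqr => /orP[/eqP//|].
  move=> /eqP/(congr1 lead_coef); rewrite lead_coefN (monicP (char_poly_monic _)).
  have /monicP-> : p \is monic.
    rewrite monicMl ?monicXn // monic_prod // => k _.
    rewrite monicE -polyC_exp lead_coefDl ?lead_coefXn // size_polyXn.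
    by rewrite (leq_ltn_trans (size_polyC_leq1 _)).
  by move=> /eqP; rewrite -addr_eq0 -mulr2n pnatr_eq0.
rewrite -horner_charE pE hornerM hornerXn horner_prod; congr (_ * _).
by apply: eq_bigr => k _; rewrite hornerD -polyC_exp hornerC hornerXn.
Qed.

End MatchingMatrix.

(** * Complex determinants *)

Lemma lipschitz_near_prod (R : realType) (m : nat) (c : 'rV[R]_m) (I : Type)
    (s : seq I) (P : pred I) (f : I -> 'rV[R]_m -> R -> R) :
  (forall i, lipschitz_near c (f i)) ->
  lipschitz_near c (fun x eps => \prod_(i <- s | P i) f i x eps).
Proof.
move=> fL; elim: s => [|i s IH].
  by apply: lipschitz_near_ext (lipschitz_near_const c 1) => x eps; rewrite big_nil.
case Pi: (P i); last first.
  by apply: lipschitz_near_ext IH => x eps; rewrite big_cons Pi.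
by apply: lipschitz_near_ext (lipschitz_nearM (fL i) IH) => x eps; rewrite big_cons Pi.
Qed.

Lemma perturbation_ext (R : realType) (m : nat) (c : 'rV[R]_m)
    (f g : 'rV[R]_m -> R -> R) :
  f =2 g -> perturbation c f -> perturbation c g.
Proof. by move=> fg [f0 [f1 [? ? fE]]]; exists f0, f1; split=> // x y; rewrite -fg. Qed.

Definition cperturbation (R : realType) (m : nat) (c : 'rV[R]_m)
    (F : 'rV[R]_m -> R -> R[i]) : Prop :=
  perturbation c (fun x eps => complex.Re (F x eps)) /\
  perturbation c (fun x eps => complex.Im (F x eps)).

Section ComplexPerturbation.
Variables (R : realType) (m : nat) (c : 'rV[R]_m).
Implicit Types F G : 'rV[R]_m -> R -> R[i].

Lemma cperturbation_const z : cperturbation c (fun _ _ => z).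
Proof. by split; apply: perturbation_const. Qed.

Lemma cperturbation_real (f : 'rV[R]_m -> R -> R) :
  perturbation c f -> cperturbation c (fun x eps => (f x eps)%:C).
Proof. by split=> //=; apply: perturbation_const. Qed.

Lemma cperturbation_ext F G : F =2 G -> cperturbation c F -> cperturbation c G.
Proof.
by move=> FG [re im]; split; [apply: perturbation_ext re|apply: perturbation_ext im];
  move=> x eps; rewrite FG.
Qed.

Lemma cperturbationD F G : cperturbation c F -> cperturbation c G ->
  cperturbation c (fun x eps => F x eps + G x eps).
Proof.
move=> [Fr Fi] [Gr Gi].
by split; [apply: perturbation_ext (perturbationD Fr Gr)|
           apply: perturbation_ext (perturbationD Fi Gi)];
  move=> x eps; case: (F x eps) => ? ?; case: (G x eps).
Qed.

Lemma cperturbationM F G : cperturbation c F -> cperturbation c G ->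
  cperturbation c (fun x eps => F x eps * G x eps).
Proof.
move=> [Fr Fi] [Gr Gi]; split.
  apply: perturbation_ext (perturbationD (perturbationM Fr Gr)
    (perturbationM (perturbation_const c (-1)) (perturbationM Fi Gi))).
  by move=> x eps; case: (F x eps) => ? ?; case: (G x eps) => ? ? /=; rewrite mulN1r.
apply: perturbation_ext (perturbationD (perturbationM Fr Gi) (perturbationM Fi Gr)).
by move=> x eps; case: (F x eps) => ? ?; case: (G x eps).
Qed.

Lemma cperturbation_sum (I : Type) (s : seq I) (P : pred I)
    (F : I -> 'rV[R]_m -> R -> R[i]) :
  (forall i, cperturbation c (F i)) ->
  cperturbation c (fun x eps => \sum_(i <- s | P i) F i x eps).
Proof.
move=> FP; elim: s => [|i s IH].
  by apply: cperturbation_ext (cperturbation_const 0) => x eps; rewrite big_nil.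
case Pi: (P i); last first.
  by apply: cperturbation_ext IH => x eps; rewrite big_cons Pi.
by apply: cperturbation_ext (cperturbationD (FP i) IH) => x eps; rewrite big_cons Pi.
Qed.

Lemma cperturbation_prod (I : Type) (s : seq I) (P : pred I)
    (F : I -> 'rV[R]_m -> R -> R[i]) :
  (forall i, cperturbation c (F i)) ->
  cperturbation c (fun x eps => \prod_(i <- s | P i) F i x eps).
Proof.
move=> FP; elim: s => [|i s IH].
  by apply: cperturbation_ext (cperturbation_const 1) => x eps; rewrite big_nil.
case Pi: (P i); last first.
  by apply: cperturbation_ext IH => x eps; rewrite big_cons Pi.
by apply: cperturbation_ext (cperturbationM (FP i) IH) => x eps; rewrite big_cons Pi.
Qed.

(** The Leibniz formula writes the determinant as sums and products of entries. *)
Lemma cperturbation_det (n : nat) (A : 'rV[R]_m -> R -> 'M[R[i]]_n) :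
  (forall i j, cperturbation c (fun x eps => A x eps i j)) ->
  cperturbation c (fun x eps => \det (A x eps)).
Proof.
move=> AP; apply: cperturbation_sum => s.
apply: cperturbationM; first exact: cperturbation_const.
by apply: cperturbation_prod => i; apply: AP.
Qed.

End ComplexPerturbation.

(** * Determinants of [z + i A] for real skew [A] *)

Section SkewDet.
Variables (R : realType) (n : nat).
Local Notation toC := (map_mx (real_complex R)).
Implicit Types (A : 'M[R]_n) (z : R).

(** Transposition turns [-z + i A] into [-(z + i A)]. A zero at [z] thus gives one at [-z], and for
    odd [n] there is always a zero at 0. *)
Lemma det_skew_opp A z : A^T = - A ->
  \det ((- z)%:C%:M + 'i *: toC A) = (-1) ^+ n * \det (z%:C%:M + 'i *: toC A).
Proof.
move=> skA; rewrite -[LHS]det_tr linearD linearZ /= tr_scalar_mx map_trmx skA.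
by rewrite -detZ scaleN1r opprD -scalerN -raddfN /= -raddfN /= map_mxN.
Qed.

(** The matrix [i A] is Hermitian: conjugating has the same effect as transposing, so the
    determinant equals its conjugate. *)
Lemma det_skew_real A z : A^T = - A ->
  complex.Im (\det (z%:C%:M + 'i *: toC A)) = 0.
Proof.
move=> skA; set d := \det _; suff : d^*%C = d.
  by case: d => p q [] /eqP; rewrite eq_sym -addr_eq0 -mulr2n mulrn_eq0 => /eqP.
rewrite /d -[RHS]det_tr -(det_map_mx (@conjc R)) linearD linearZ /= tr_scalar_mx.
congr (\det _); apply/matrixP=> i j; have /matrixP/(_ i j) := skA; rewrite !mxE => ->.
rewrite rmorphD rmorphMn rmorphM rmorphN mulrN -mulNr -complexiE.
congr (_ *+ _ + _ * _); [exact: conjc_real| |exact: conjc_real].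
by apply/eqP; rewrite eq_complex /= oppr0 !eqxx.
Qed.

(** Because [i ^ 2 = -1], the matrix [i z - A] is [i (z + i A)]. *)
Lemma root_char_poly_skew A z :
  root (char_poly (toC A)) ('i * z%:C) = (\det (z%:C%:M + 'i *: toC A) == 0).
Proof.
rewrite rootE /char_poly -horner_evalE -det_map_mx.
set M := map_mx _ _; have -> : M = 'i *: (z%:C%:M + 'i *: toC A).
  apply/matrixP=> i j; rewrite !mxE /= horner_evalE hornerD hornerN hornerMn hornerX.
  by rewrite hornerC mulrDr mulrA -expr2 sqrCi mulN1r mulrnAr.
by rewrite detZ mulf_eq0 expf_eq0 (negPf (neq0Ci _)) andbF.
Qed.

End SkewDet.

(** * Existence *)

Section Realization.
Variables (R : realType) (n m : nat) (e : rel 'I_n) (a b : 'I_m -> 'I_n).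
Hypotheses (e_sym : symmetric e) (e_irr : irreflexive e).
Hypothesis ab : matching_ends e a b.
Local Notation toC := (map_mx (real_complex R)).

Definition matched (i j : 'I_n) : bool :=
  [exists k, (i == a k) && (j == b k) || (i == b k) && (j == a k)].

(** The order of the two indices chooses the sign, which makes the matrix skew. *)
Definition off_matching_mx : 'M[R]_n :=
  \matrix_(i, j) if e i j && ~~ matched i j then (if (i < j)%N then 1 else -1)
                 else 0.

Definition perturbed_mx (x : 'rV[R]_m) (eps : R) : 'M[R]_n :=
  matching_mx a b (x 0) + eps *: off_matching_mx.

Lemma matchedC i j : matched i j = matched j i.
Proof.
by apply: eq_existsb => k; rewrite orbC; congr (_ || _); rewrite andbC.
Qed.

Lemma tr_perturbed_mx x eps : (perturbed_mx x eps)^T = - perturbed_mx x eps.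
Proof.
rewrite /perturbed_mx linearD linearZ /= tr_matching_mx opprD -scalerN.
congr (_ + _ *: _); apply/matrixP=> i j; rewrite !mxE e_sym matchedC.
case: ifP => [/andP[eij _]|]; last by rewrite oppr0.
case: (ltngtP i j) => [| |ij]; rewrite ?opprK //.
by move: eij; rewrite (ord_inj ij) e_irr.
Qed.

(** The two summands have disjoint supports, so no cancellation occurs: entries are [x_k] up to sign
    on matched edges and [eps] up to sign on the other edges. *)
Lemma skew_perturbed_mx (x : 'rV[R]_m) eps :
  eps != 0 -> (forall k, x 0 k != 0) -> skew_of_graph e (perturbed_mx x eps).
Proof.
have [eab _ _ _] := ab => eps0 x0; split=> [|i j ij].
  exact: tr_perturbed_mx.
have [mij|nmij] := boolP (matched i j).
  have -> : e i j.
    by case/existsP: mij => k /orP[] /andP[/eqP-> /eqP->]; [|rewrite e_sym];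
      apply: eab.
  split=> // _; rewrite !mxE mij andbF mulr0 addr0.
  case/existsP: mij => k /orP[/andP[/eqP-> /eqP->]|/andP[/eqP-> /eqP->]].
    by rewrite (matching_mx_entry ab).
  have /matrixP/(_ (b k) (a k)) := tr_matching_mx a b (x 0).
  by rewrite !mxE (matching_mx_entry ab) -oppr_eq0 => <-.
rewrite !mxE matching_mx_eq0 ?add0r => [|k]; last first.
  by apply: contra nmij => H; apply/existsP; exists k.
rewrite nmij andbT; case: (e i j); last by rewrite mulr0 eqxx.
split=> // _; rewrite mulf_neq0 //; case: ifP => _; rewrite ?oppr_eq0 oner_neq0 //.
Qed.

Lemma perturbed_mx_perturbation (c : 'rV[R]_m) i j :
  perturbation c (fun x eps => perturbed_mx x eps i j).
Proof.
have entE (x : 'rV[R]_m) eps : perturbed_mx x eps i j =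
    \sum_k (x 0 k) * (delta_mx (a k) (b k) - delta_mx (b k) (a k) : 'M_n) i j
    + eps * off_matching_mx i j.
  rewrite mxE summxE [X in _ + X]mxE; congr (_ + _).
  by apply: eq_bigr => k _; rewrite mxE.
apply: (perturbation_ext (fun x eps => esym (entE x eps))).
apply: perturbationD; last first.
  exact: perturbationM (perturbation_eps _) (perturbation_const _ _).
elim: (index_enum _) => [|k s IH].
  by apply: perturbation_ext (perturbation_const c 0) => x eps; rewrite big_nil.
apply: perturbation_ext (perturbationD (perturbationM (perturbation_coord c k)
  (perturbation_const c _)) IH) => x eps.
by rewrite big_cons.
Qed.

Lemma det_matching_eps0 (x : 'rV[R]_m) (z : R) :
  \det (z%:C%:M + 'i *: toC (perturbed_mx x 0)) =
  (z ^+ (n - 2 * m) * \prod_k (z ^+ 2 - x 0 k ^+ 2))%:C.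
Proof.
(* The imaginary weights absorb the factor [i]; their squares [- x_k ^ 2] produce the minus sign in
   the product. *)
have -> : z%:C%:M + 'i *: toC (perturbed_mx x 0) =
    z%:C%:M - matching_mx a b (fun k => - 'i * (x 0 k)%:C).
  congr (_ + _); rewrite /perturbed_mx scale0r addr0 /matching_mx -sumrN.
  rewrite raddf_sum scaler_sumr /=; apply: eq_bigr => k _.
  by rewrite map_mxZ map_mxB !map_delta_mx scalerA -scaleNr mulNr opprK.
rewrite (det_sub_matching_mx ab) rmorphM rmorphXn rmorph_prod; congr (_ * _).
apply: eq_bigr => k _.
by rewrite rmorphB !rmorphXn exprMn sqrrN sqrCi mulN1r.
Qed.

Lemma perturbed_mx_realizes (c : 'rV[R]_m) :
  (forall k, c 0 k != 0) ->
  (forall k l, k != l -> c 0 k ^+ 2 != c 0 l ^+ 2) ->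
  exists A : 'M[R]_n, skew_of_graph e A /\
    forall k, \det ((c 0 k)%:C%:M + 'i *: toC A) = 0.
Proof.
move=> c0 cinj.
pose f k x eps := complex.Re (\det ((c 0 k)%:C%:M + 'i *: toC (perturbed_mx x eps))).
(* The cofactor of [x_k ^ 2 - c_k ^ 2] in the determinant at [eps = 0]; the minus sign comes from
   reversing that difference. Distinct squares make it nonzero at [c]. *)
pose u (k : 'I_m) (x : 'rV[R]_m) :=
  - c 0 k ^+ (n - 2 * m) * \prod_(l | l != k) (c 0 k ^+ 2 - x 0 l ^+ 2).
(* The radius [L^-1] is smaller than every [|c_k|], which keeps all matching weights nonzero. *)
have [L L0 LP] : exists2 L, 0 < L & forall k, 1 < L * `|c 0 k|.
  apply: uniform_bound => [k p q pq /lt_le_trans-> //|k].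
    by rewrite ler_wpM2r.
  exists (2 / `|c 0 k|); first by rewrite mulr_ge0 ?invr_ge0.
  by rewrite divfK ?normr_eq0 // ltr1n.
have [k|k|k x|//|k||x [eps [eps0 cx fx]]] :=
    @perturbed_zero R m c L^-1 f u.
- have [//] : cperturbation c (fun x eps =>
    \det ((c 0 k)%:C%:M + 'i *: toC (perturbed_mx x eps))).
  apply: cperturbation_det => i j.
  apply: (@cperturbation_ext _ _ _ (fun x eps => (c 0 k)%:C *+ (i == j) +
    'i * (perturbed_mx x eps i j)%:C)) => [x eps|]; first by rewrite !mxE.
  apply: cperturbationD; first exact: cperturbation_const.
  apply: cperturbationM; first exact: cperturbation_const.
  exact/cperturbation_real/perturbed_mx_perturbation.
- apply: lipschitz_nearM; first exact: lipschitz_near_const.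
  apply: (@lipschitz_near_prod _ _ _ _ _ _ (fun l x _ => c 0 k ^+ 2 - x 0 l ^+ 2)).
  move=> l; apply: lipschitz_nearD; first exact: lipschitz_near_const.
  apply: lipschitz_near_ext (lipschitz_nearM (lipschitz_near_const c (-1))
    (lipschitz_nearM (lipschitz_near_coord c l) (lipschitz_near_coord c l))).
  by move=> x eps; rewrite mulN1r.
- rewrite /f det_matching_eps0 /= /u (bigD1 k) //=; ring.
- rewrite mulf_neq0 ?oppr_eq0 ?expf_neq0 //.
  apply/prodf_neq0 => l lk; rewrite subr_eq0; apply: cinj.
  by rewrite eq_sym.
- by rewrite invr_gt0.
exists (perturbed_mx x eps); split=> [|k]; last first.
  have := fx k; rewrite /f; have := det_skew_real (c 0 k) (tr_perturbed_mx x eps).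
  by case: (\det _) => p q /= -> ->.
apply: skew_perturbed_mx => // k; apply/eqP=> xk0.
have := cx k; rewrite xk0 sub0r normrN -[_ <= _](ler_pM2l L0) divff ?gt_eqF //.
by rewrite leNgt LP.
Qed.

End Realization.

Lemma matching_spectrum_realizable (R : realType) (n : nat) (e : rel 'I_n)
    (lambda : 'I_n -> R) :
  simple_graph e -> matching_number e = (n %/ 2)%N -> injective lambda ->
  (forall j, lambda j = - lambda (rev_ord j)) ->
  exists A : 'M[R]_n, skew_of_graph e A /\
    has_eigenvalues A [seq 'i * (lambda j)%:C | j <- enum 'I_n].
Proof.
move=> [e_sym e_irr] eM linj lrev.
have [M Mm cM] : exists2 M, is_matching e M & #|M| = (n %/ 2)%N.
  have M0 : is_matching e set0.
    by rewrite /is_matching sub0set; apply/trivIsetP=> B B'; rewrite inE.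
  have [M Mm cM] := eq_bigmax_cond (fun M : {set {set 'I_n}} => #|M|)
    (introT card_gt0P (ex_intro (fun M => M \in is_matching e) _ M0)).
  by exists M => //; rewrite -eM -cM.
have [a [b ab]] := matching_ends_exist e_irr Mm cM.
(* Only the first half of the spectrum is prescribed. The opposites have indices in the second half,
   and for odd [n] the middle index is left out. *)
pose w (k : 'I_(n %/ 2)) : 'I_n := widen_ord (leq_div n 2) k.
have w_rev k l : w k != rev_ord (w l).
  by apply/eqP=> /(congr1 val) /=; have := ltn_ord k; have := ltn_ord l; lia.
pose c : 'rV[R]_(n %/ 2) := \row_k lambda (w k).
have [k|k l kl|A [skA detA]] := @perturbed_mx_realizes R n _ e a b e_sym e_irr ab c.
- rewrite mxE; apply/eqP=> lk; have := w_rev k k; rewrite -(inj_eq linj) lk.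
  by rewrite -[lambda _]opprK -lrev lk oppr0 eqxx.
- rewrite !mxE eqf_sqr negb_or (inj_eq linj) (lrev (w l)) opprK.
  rewrite (inj_eq linj) w_rev andbT; apply: contra kl => /eqP/(congr1 val) /=.
  by move=> kl; apply/eqP/val_inj.
exists A; split=> //; have [skA' _] := skA.
have detw (j : 'I_n) : (j < n %/ 2)%N ->
    \det ((lambda j)%:C%:M + 'i *: map_mx (real_complex R) A) = 0.
  move=> jn; have := detA (Ordinal jn); rewrite mxE.
  by have -> : w (Ordinal jn) = j by apply: val_inj.
have detl j : \det ((lambda j)%:C%:M + 'i *: map_mx (real_complex R) A) = 0.
  have [/detw//|jn] := ltnP j (n %/ 2).
  rewrite lrev det_skew_opp //; have [/detw->|rjn] := ltnP (rev_ord j) (n %/ 2).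
    by rewrite mulr0.
  (* If neither [j] nor its mirror lies in the first half, [j] is the middle index: [n] is odd, the
     eigenvalue is 0, and the determinant equals its own opposite. *)
  have jE : rev_ord j = j.
    by apply: val_inj; move: rjn => /=; have := ltn_ord j; lia.
  have l0 : lambda j = 0.
    have /eqP := lrev j; rewrite jE -addr_eq0 -mulr2n mulrn_eq0 => /eqP //.
  have nodd : odd n.
    have /(congr1 val) /= := jE; have := ltn_ord j; lia.
  have := det_skew_opp (lambda j) skA'; rewrite jE l0 oppr0 -signr_odd nodd expr1 mulN1r.
  by move=> /eqP; rewrite -addr_eq0 -mulr2n mulrn_eq0 /= => /eqP->; rewrite oppr0.
rewrite /has_eigenvalues; set p := char_poly _; set s := map _ _.
have ss : size s = n by rewrite size_map size_enum_ord.
(* A monic polynomial of degree [n] with [n] distinct known roots is the product of its linear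
   factors. *)
rewrite {1}(@all_roots_prod_XsubC _ p s) ?(monicP (char_poly_monic _)) ?scale1r //.
- by rewrite size_char_poly ss.
- by apply/allP=> _ /mapP[j _ ->]; rewrite root_char_poly_skew detl.
rewrite uniq_rootsE map_inj_uniq ?enum_uniq // => j l /(mulfI (neq0Ci _)) [].
exact: linj.
Qed.

(** * Necessity *)

Definition supported_on (F : fieldType) (n : nat) (U : {set 'I_n})
    (v : 'rV[F]_n) :=
  forall j, j \notin U -> v 0 j = 0.

(** Nonsingularity of the principal submatrix on [U], stated with vectors of full length so that [U]
    can shrink without reindexing. *)
Definition nonsingular_on (F : fieldType) (n : nat) (A : 'M[F]_n)
    (U : {set 'I_n}) :=
  forall v : 'rV[F]_n, supported_on U v ->
    (forall j, j \in U -> (v *m A) 0 j = 0) -> v = 0.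

Lemma nonsingular_on_solve (F : fieldType) (n : nat) (A : 'M[F]_n)
    (U : {set 'I_n}) (i : 'I_n) :
  nonsingular_on A U -> i \in U ->
  exists2 w : 'rV[F]_n, supported_on U w &
    forall j, j \in U -> (w *m A) 0 j = (j == i)%:R.
Proof.
move=> nsU iU.
(* Columns outside [U] are replaced by those of the identity; this makes the whole matrix
   invertible. *)
pose C : 'M[F]_n := \matrix_(k, j) if j \in U then A k j else (k == j)%:R.
have CE (v : 'rV[F]_n) j :
    (v *m C) 0 j = if j \in U then (v *m A) 0 j else v 0 j.
  rewrite mxE; case: ifP => jU.
    by rewrite mxE; apply: eq_bigr => k _; rewrite mxE jU.
  rewrite (bigD1 j) //= big1 ?addr0 => [|k /negPf kj].
    by rewrite mxE jU eqxx mulr1.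
  by rewrite mxE jU kj mulr0.
have Cunit : C \in unitmx.
  rewrite -row_free_unit -kermx_eq0; apply/eqP/row_matrixP=> k.
  rewrite row0; apply: nsU => [j jU|j jU].
    have := CE (row k (kermx C)) j.
    by rewrite (negPf jU) -row_mul mulmx_ker row0 [LHS]mxE => <-.
  by have := CE (row k (kermx C)) j; rewrite jU -row_mul mulmx_ker row0 [LHS]mxE => <-.
pose w : 'rV[F]_n := delta_mx 0 i *m invmx C.
have wC : w *m C = delta_mx 0 i by rewrite mulmxKV.
exists w => j jU.
  have := CE w j; rewrite (negPf jU) wC mxE => <-.
  by have /negPf-> : j != i by apply: contraNneq jU => ->.
by have := CE w j; rewrite jU wC mxE.
Qed.

Lemma dot_skew (F : fieldType) (n : nat) (A : 'M[F]_n) (v w : 'rV[F]_n) :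
  A^T = - A ->
  \sum_j (v *m A) 0 j * w 0 j = - \sum_j (w *m A) 0 j * v 0 j.
Proof.
have dotE (x y : 'rV[F]_n) : \sum_j x 0 j * y 0 j = (x *m y^T) 0 0.
  by rewrite mxE; apply: eq_bigr => j _; rewrite mxE.
move=> skA; rewrite !dotE.
have -> : (v *m A *m w^T) 0 0 = (v *m A *m w^T)^T 0 0 by rewrite [RHS]mxE.
by rewrite trmx_mul trmxK trmx_mul skA mulNmx mulmxN mulmxA [LHS]mxE.
Qed.

(* Removing an edge [i j] with [w j != 0], where [w] solves [w A = e_i] on
   [U], keeps the principal submatrix nonsingular: this replaces the Pfaffian
   expansion. *)
Lemma nonsingular_on_edge (F : numFieldType) (n : nat) (A : 'M[F]_n)
    (U : {set 'I_n}) (i : 'I_n) :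
  A^T = - A -> nonsingular_on A U -> i \in U ->
  exists j, [/\ j \in U, j != i, A i j != 0 &
    nonsingular_on A (U :\ i :\ j)].
Proof.
move=> skA nsU iU; have [w wU wA] := nonsingular_on_solve nsU iU.
have dotw (v : 'rV[F]_n) : supported_on U v -> \sum_j (w *m A) 0 j * v 0 j = v 0 i.
  move=> vU; rewrite (bigD1 i) //= big1 ?addr0 => [|j ji].
    by rewrite wA // eqxx mul1r.
  have [jU|/vU->] := boolP (j \in U); last by rewrite mulr0.
  by rewrite wA // (negPf ji) mul0r.
(* By skewness [w A w^T] vanishes, and it also equals [w_i]. *)
have wi0 : w 0 i = 0.
  have := dot_skew w w skA; rewrite dotw // => /eqP.
  by rewrite -addr_eq0 -mulr2n mulrn_eq0 /= => /eqP.
have [j wj Aji] : exists2 j, w 0 j != 0 & A j i != 0.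
  have : (w *m A) 0 i != 0 by rewrite wA // eqxx oner_eq0.
  rewrite mxE; case: (pickP (fun j => (w 0 j != 0) && (A j i != 0))).
    by move=> j /andP[]; exists j.
  move=> H; rewrite big1 ?eqxx // => j _; apply/eqP; rewrite mulf_eq0.
  by have /negbT := H j; rewrite negb_and !negbK.
have jU : j \in U by apply: contraR wj => /wU ->.
have ji : j != i by apply: contraNneq wj => ->; rewrite wi0.
exists j; split=> //.
  by have /matrixP/(_ i j) := skA; rewrite !mxE -oppr_eq0 => <-.
move=> v vW vA.
have vU : supported_on U v.
  by move=> k kU; apply: vW; rewrite !inE (negPf kU) !andbF.
have vAl k : k \in U -> k != i -> k != j -> (v *m A) 0 k = 0.
  by move=> kU ki kj; apply: vA; rewrite !inE kj ki.
(* Pairing [v A] with [w] gives [- v_i = 0], and only the term at [j] survives in the sum because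
   [w_i = 0]. *)
have vj0 : (v *m A) 0 j = 0.
  have := dot_skew v w skA; rewrite dotw // vW ?inE ?eqxx ?andbF // oppr0.
  rewrite (bigD1 j) //= big1 ?addr0 => [/eqP|k kj].
    by rewrite mulf_eq0 (negPf wj) orbF => /eqP.
  have [->|ki] := eqVneq k i; first by rewrite wi0 mulr0.
  have [kU|/wU->] := boolP (k \in U); last by rewrite mulr0.
  by rewrite vAl ?mul0r.
(* On [U] the vector [v A] is a multiple of [e_i], so [v] is that multiple of [w]; comparing
   coordinates at [j], where [v_j = 0] and [w_j != 0], the multiple is 0. *)
have vE : v - (v *m A) 0 i *: w = 0.
  apply: nsU => k kU; first by rewrite !mxE vU // wU // mulr0 subrr.
  set c := (v *m A) 0 i; rewrite mulmxBl -scalemxAl mxE [X in _ + X]mxE.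
  rewrite [X in _ - X]mxE {}/c wA //; have [->|ki] := eqVneq k i; first by rewrite mulr1 subrr.
  rewrite mulr0 subr0; have [->//|kj] := eqVneq k j.
  exact: vAl.
have : (v - (v *m A) 0 i *: w) 0 j = 0 by rewrite vE mxE.
rewrite [LHS]mxE (vW j) ?inE ?eqxx // add0r => /eqP.
rewrite mxE oppr_eq0 mxE mulf_eq0 (negPf wj) orbF => /eqP vi0.
by move: vE; rewrite vi0 scale0r subr0.
Qed.

(** * Counting vertices covered by matchings *)

Lemma card_cover_matching (n : nat) (e : rel 'I_n) (M : {set {set 'I_n}}) :
  irreflexive e -> is_matching e M -> #|cover M| = (2 * #|M|)%N.
Proof.
move=> irr /andP[/subsetP Me /eqP <-].
rewrite (eq_bigr (fun=> 2)) ?sum_nat_const ?(mulnC 2) // => B /Me.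
case/imset2P=> x y _; rewrite inE /= => exy ->; rewrite cards2.
by case: eqP exy => // ->; rewrite irr.
Qed.

Lemma card_matching_le (n : nat) (e : rel 'I_n) (M : {set {set 'I_n}}) :
  irreflexive e -> is_matching e M -> (#|M| <= n %/ 2)%N.
Proof.
move=> irr /(card_cover_matching irr) cM.
have := max_card (mem (cover M)); rewrite cM card_ord; lia.
Qed.

Lemma matching_number_eq_half (n : nat) (e : rel 'I_n) (M : {set {set 'I_n}}) :
  irreflexive e -> is_matching e M -> #|M| = (n %/ 2)%N ->
  matching_number e = (n %/ 2)%N.
Proof.
move=> irr Mm cM; apply/eqP; rewrite eqn_leq; apply/andP; split.
  by apply/bigmax_leqP=> M' /(card_matching_le irr).
by rewrite -cM; apply: (leq_bigmax_cond (F := fun X : {set {set 'I_n}} => #|X|)).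
Qed.

Lemma nonsingular_on_matching (F : numFieldType) (n : nat) (e : rel 'I_n)
    (A : 'M[F]_n) (U : {set 'I_n}) :
  A^T = - A -> (forall i j, i != j -> A i j != 0 -> e i j) ->
  nonsingular_on A U -> exists2 M, is_matching e M & cover M = U.
Proof.
move=> skA Ae; have [k] := ubnP #|U|; elim: k U => // k IH U leU nsU.
have [->|[i iU]] := set_0Vmem U.
  exists set0; last by rewrite /cover big_set0.
  rewrite /is_matching sub0set /=; apply/trivIsetP=> B B'.
  by rewrite inE.
have [j [jU ji Aij nsW]] := nonsingular_on_edge skA nsU iU.
have [|M /andP[Me tM] cM] := IH _ _ nsW.
  move: leU; rewrite (cardsD1 i U) iU (cardsD1 j (U :\ i)) in_setD1 ji jU.
  by rewrite !add1n !ltnS => /ltnW.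
exists ([set i; j] |: M).
  apply/andP; split.
    rewrite subUset Me andbT sub1set; apply/imset2P.
    by exists i j => //; rewrite inE /= Ae // eq_sym.
  apply: trivIsetU (trivIset1 _) tM _.
  rewrite cover1 cM -setI_eq0; apply/eqP/setP=> l; rewrite !inE.
  by case: (l == i); case: (l == j); rewrite ?andbF.
rewrite /cover bigcup_setU big_set1 -/(cover M) cM; apply/setP=> l.
rewrite !inE; case: (eqVneq l i) => [->|_] /=; first by rewrite iU.
by case: (eqVneq l j) => [->|_] /=; rewrite ?jU.
Qed.

(** * The kernel of a skew matrix with simple spectrum *)

Lemma char_poly_similar (F : fieldType) (n : nat) (P A : 'M[F]_n) :
  P \in unitmx -> char_poly (invmx P *m A *m P) = char_poly A.
Proof.
move=> Pu; rewrite /char_poly /char_poly_mx.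
pose Q := map_mx (@polyC F) P; pose Q' := map_mx (@polyC F) (invmx P).
have QQ : Q' *m Q = 1%:M by rewrite -map_mxM mulVmx // map_mx1.
have -> : 'X%:M - map_mx (@polyC F) (invmx P *m A *m P)
   = Q' *m ('X%:M - map_mx (@polyC F) A) *m Q.
  by rewrite mulmxBr mulmxBl !map_mxM scalar_mxC -(mulmxA _ Q' Q) QQ mulmx1.
by rewrite !det_mulmx mulrC mulrA -det_mulmx (mulmx1C QQ) det1 mul1r.
Qed.

Lemma skew_complex_normal (R : realType) (n : nat) (A : 'M[R]_n) :
  A^T = - A -> map_mx (real_complex R) A \is normalmx.
Proof.
move=> skA; apply/normalmxP.
have -> : ((map_mx (real_complex R) A)^t*)%sesqui = - map_mx (real_complex R) A.
  apply/matrixP=> i j; rewrite !mxE.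
  have /matrixP/(_ i j) := skA; rewrite !mxE => ->.
  by rewrite !rmorphN; congr (- _); apply: conjc_real.
by rewrite mulNmx mulmxN.
Qed.

(** In a unitary eigenbasis a kernel vector lives on the coordinates with eigenvalue 0, and there is
    only one. Hence [w] is proportional to [v], and coordinate [i] forces the factor to be 0. *)
Lemma skew_simple_spectrum_kernel (R : realType) (n : nat) (A : 'M[R]_n)
    (s : seq R[i]) (v w : 'rV[R]_n) (i : 'I_n) :
  A^T = - A -> has_eigenvalues A s -> uniq s ->
  v *m A = 0 -> w *m A = 0 -> v 0 i != 0 -> w 0 i = 0 -> w = 0.
Proof.
move=> skA As us vA wA vi wi; set C := map_mx (real_complex R) A.
have /orthomx_spectralP := skew_complex_normal skA.
rewrite -/C; set P := spectralmx C; set d := spectral_diag C => CE.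
have Pu : P \in unitmx by apply: spectral_unit.
(* Both lists factor the same characteristic polynomial, so the spectral diagonal is a permutation
   of [s]. *)
have ud : uniq [seq d 0 k | k <- enum 'I_n].
  rewrite (@perm_uniq _ _ s) //.
  have := As; rewrite /has_eigenvalues -/C CE char_poly_similar //.
  rewrite char_poly_trig ?diag_mx_is_trig //.
  rewrite (eq_bigr (fun k => 'X - (d 0 k)%:P)) => [|k _]; last first.
    by rewrite mxE eqxx mulr1n.
  rewrite -big_enum -(big_map (d 0) predT (fun z => 'X - z%:P)) /=.
  by move=> H; apply: prod_XsubC_eq.
have dinj : injective (d 0) by apply/injectiveP.
have kerE (u : 'rV[R]_n) : u *m A = 0 ->
    forall k, (map_mx (real_complex R) u *m invmx P) 0 k * d 0 k = 0.
  move=> uA k.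
  have : map_mx (real_complex R) u *m C = 0 by rewrite -map_mxM uA map_mx0.
  rewrite CE !mulmxA => /(congr1 (mulmx^~ (invmx P))); rewrite mulmxK // mul0mx.
  by move/matrixP/(_ 0 k); rewrite mul_mx_diag !mxE.
have [v' v'E] : exists v', v' = map_mx (real_complex R) v *m invmx P by eexists.
have [w' w'E] : exists w', w' = map_mx (real_complex R) w *m invmx P by eexists.
have v'P : v' *m P = map_mx (real_complex R) v by rewrite v'E mulmxKV.
have w'P : w' *m P = map_mx (real_complex R) w by rewrite w'E mulmxKV.
have [k v'k] : exists k, v' 0 k != 0.
  apply/existsP; apply: contraNT vi => /existsPn v'0.
  have {}v'0 : v' = 0.
    by apply/rowP=> k; rewrite [RHS]mxE; have := v'0 k; rewrite negbK => /eqP.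
  move: v'P; rewrite v'0 mul0mx => /matrixP/(_ 0 i); rewrite !mxE => /esym/eqP.
  by rewrite fmorph_eq0.
have dk : d 0 k = 0.
  by apply/eqP; have /eqP := kerE v vA k; rewrite -v'E mulf_eq0 (negPf v'k).
have off (u : 'rV[R]_n) l : u *m A = 0 -> l != k ->
    (map_mx (real_complex R) u *m invmx P) 0 l = 0.
  move=> uA lk; apply/eqP; have /eqP := kerE u uA l.
  rewrite mulf_eq0 => /orP[//|]; rewrite -dk => /eqP/dinj lk'.
  by rewrite lk' eqxx in lk.
have prop : v' 0 k *: w' = w' 0 k *: v'.
  apply/rowP=> l; rewrite !mxE; have [->|lk] := eqVneq l k; first exact: mulrC.
  have -> : w' 0 l = 0 by rewrite w'E off.
  have -> : v' 0 l = 0 by rewrite v'E off.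
  by rewrite !mulr0.
have w'k : w' 0 k = 0.
  have /(congr1 (mulmx^~ P)) := prop; rewrite -!scalemxAl v'P w'P.
  move/matrixP/(_ 0 i); rewrite !mxE wi rmorph0 mulr0 => /esym/eqP.
  by rewrite mulf_eq0 fmorph_eq0 (negPf vi) orbF => /eqP.
have w'0 : w' = 0.
  move/eqP: prop; rewrite w'k scale0r scaler_eq0 (negPf v'k) /=.
  by move/eqP.
apply/rowP=> l; apply/eqP; move: w'P; rewrite w'0 mul0mx => /matrixP/(_ 0 l).
by rewrite !mxE => /esym/eqP; rewrite fmorph_eq0.
Qed.

Lemma simple_spectrum_matching (R : realType) (n : nat) (e : rel 'I_n)
    (A : 'M[R]_n) (s : seq R[i]) :
  irreflexive e -> skew_of_graph e A -> has_eigenvalues A s -> uniq s ->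
  matching_number e = (n %/ 2)%N.
Proof.
move=> irr [skA eA] As us.
have Ae i j : i != j -> A i j != 0 -> e i j by move=> ij; case: (eA i j ij).
(* A perfect matching of a set missing at most one vertex already has [n %/ 2] edges. *)
suff [U nsU cU] : exists2 U, nonsingular_on A U & (n <= #|U|.+1)%N.
  have [M Mm cM] := nonsingular_on_matching skA Ae nsU.
  apply: (matching_number_eq_half irr Mm).
  have := card_cover_matching irr Mm; have := card_matching_le irr Mm.
  rewrite cM; lia.
have [A0|/rowV0Pn[v /sub_kermxP vA v0]] := eqVneq (kermx A) 0.
  exists [set: 'I_n]; last by rewrite cardsT card_ord.
  move=> v _ vA; apply/eqP; rewrite -submx0 -A0; apply/sub_kermxP/rowP=> j.
  by rewrite [RHS]mxE vA ?inE.
have [i vi] : exists i, v 0 i != 0.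
  apply/existsP; apply: contraNT v0 => /existsPn v0.
  by apply/eqP/rowP=> k; rewrite [RHS]mxE; have := v0 k; rewrite negbK => /eqP.
(* The vertex removed is one where the kernel vector [v] is nonzero. *)
exists (~: [set i]); last by rewrite cardsC1 card_ord leqSpred.
move=> w wU wA.
have wi : w 0 i = 0 by apply: wU; rewrite !inE negbK.
(* Pairing [w A] with [v] gives 0 because [v A = 0], and only the term at [i] remains. So [w] lies
   in the kernel and vanishes at [i]. *)
have wAi : (w *m A) 0 i = 0.
  have := dot_skew w v skA; rewrite vA [X in _ = - X]big1 => [|j _]; last first.
    by rewrite mxE mul0r.
  rewrite (bigD1 i) //= big1 => [|j ji]; last by rewrite wA ?mul0r // !inE.
  by rewrite addr0 oppr0 => /eqP; rewrite mulf_eq0 (negPf vi) orbF => /eqP.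
apply: (skew_simple_spectrum_kernel skA As us vA _ vi wi).
apply/rowP=> j; rewrite [RHS]mxE; have [->//|ji] := eqVneq j i.
by rewrite wA // !inE.
Qed.

Theorem theorem2p4 (R : realType) (n : nat) (e : rel 'I_n)
    (hG : simple_graph e) (hconn : connected_graph e) :
  (matching_number e = (n %/ 2)%N ->
   forall lambda : 'I_n -> R,
     injective lambda ->
     (forall j : 'I_n, lambda j = - lambda (rev_ord j)) ->
     exists A : 'M[R]_n,
       skew_of_graph e A /\
       has_eigenvalues A [seq 'i * (lambda j)%:C | j <- enum 'I_n])
  /\
  ((exists (A : 'M[R]_n) (s : seq R[i]),
      [/\ skew_of_graph e A, has_eigenvalues A s & uniq s]) ->
   matching_number e = (n %/ 2)%N).
Proof.
split=> [eM lambda linj lrev|[A [s [skA As us]]]].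
  exact: matching_spectrum_realizable.
by case: hG => _ e_irr; apply: simple_spectrum_matching skA As us.
Qed.
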